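(* For every $\gamma_0>0$ there exists $\gamma>0$, depending only on $\gamma_0$, such that $$\mathcal{F}_{\gamma_0}\cup\mathcal{C}_{\gamma_0}\cup\mathcal{M}_{\gamma_0}\subseteq \mathcal{F}_{\gamma}\cap\mathcal{C}_{\gamma}\cap\mathcal{M}_{\gamma}.$$ That is, if a finite simple graph $G$ with $n\ge 2$ vertices satisfies at least one of the conditions (i) $\lambda_2(G)\ge \gamma_0 n$, (ii) $i(G)\ge\gamma_0 n$, (iii) $\min_j d_j\ge\gamma_0 n$ and $1-\chi_2(G)\ge\gamma_0$, then it satisfies all three of them with $\gamma_0$ replaced by $\gamma$.
   Context: All graphs are finite undirected simple graphs $G$ with vertex set $VG=\{v_1,\dots,v_n\}$, $n\ge 2$, and edge set $EG$; $d_j$ is the degree of $v_j$. The Laplacian matrix $Q$ is the $n\times n$ matrix with $Q_{jj}=d_j$, $Q_{jk}=-1$ if $\{v_j,v_k\}\in EG$, and $Q_{jk}=0$ otherwise; its eigenvalues are $0=\lambda_1\le\lambda_2\le\dots\le\lambda_n$, and $\lambda_2(G)$ is the algebraic connectivity. For $A\subseteq VG$, $\partial A$ is the set of edges with exactly one endpoint in $A$, and the Cheeger constant is $i(G)=\min\{|\partial A|/|A| : A\subset VG,\ 0<|A|\le n/2\}$. When all degrees are positive, $P$ is the transition matrix of the simple random walk: $P_{jk}=1/d_j$ if $\{v_j,v_k\}\in EG$ and $0$ otherwise; its eigenvalues are real, $1=\chi_1\ge\chi_2\ge\dots\ge\chi_n\ge -1$, and $\chi_2(G)$ denotes the second largest.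 For $\gamma>0$: $\mathcal{F}_\gamma$ is the set of graphs with $\lambda_2(G)\ge\gamma|VG|$; $\mathcal{C}_\gamma$ is the set of graphs with $i(G)\ge\gamma|VG|$; $\mathcal{M}_\gamma$ is the set of graphs with $\min_j d_j\ge\gamma|VG|$ (so $P$ is defined) and $1-\chi_2(G)\ge\gamma$. *)

(* Defs.v *)
From HB Require Import structures.
From mathcomp Require Import all_boot all_order all_algebra.
From mathcomp Require Import classical_sets reals.
From mathcomp Require Import polyrcf.

Set Implicit Arguments.
Unset Strict Implicit.
Unset Printing Implicit Defensive.

Import Order.TTheory GRing.Theory Num.Theory.
Local Open Scope ring_scope.

(* Undirected and simple by construction: an edge is a 2-element set of
   vertices, and [edges] is a set, so there are no loops or multiple edges. *)
Record graph := Graph {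
  nverts : nat;
  nverts_ge2 : (1 < nverts)%N;
  edges : {set {set 'I_nverts}};
  edges_card2 : forall e, e \in edges -> #|e| = 2%N
}.

Definition vertex0 (G : graph) : 'I_(nverts G) := Ordinal (ltnW (nverts_ge2 G)).

Definition deg (G : graph) (j : 'I_(nverts G)) : nat :=
  #|[set e in edges G | j \in e]%SET|.

Definition min_deg (G : graph) : nat :=
  deg [arg min_(j < vertex0 G) deg j]%N.

Definition boundary (G : graph) (A : {set 'I_(nverts G)}) :
    {set {set 'I_(nverts G)}} :=
  [set e in edges G | #|(e :&: A)%SET| == 1%N]%SET.

Section Spectral.
Variable R : realType.

(* The real roots of the characteristic polynomial in nondecreasing order
   ([rootsR] is increasing and duplicate-free), each repeated according to its
   algebraic multiplicity. *)
Definition spectrum (n : nat) (A : 'M[R]_n) : seq R :=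
  flatten [seq nseq (mup x (char_poly A)) x | x <- rootsR (char_poly A)].

Definition laplacian (G : graph) : 'M[R]_(nverts G) :=
  \matrix_(j, k) if j == k then (deg j)%:R
                 else if [set j; k]%SET \in edges G then -1 else 0.

(* [nth] counts from 0, so index 1 is the second eigenvalue. *)
Definition lambda2 (G : graph) : R := (spectrum (laplacian G))`_1%N.

Definition cheeger_ratio (G : graph) (A : {set 'I_(nverts G)}) : R :=
  #|boundary A|%:R / #|A|%:R.

(* The candidate set in the [arg min] is a singleton, which is admissible
   since [nverts G >= 2]; hence this is the minimum over all admissible sets. *)
Definition cheeger (G : graph) : R :=
  cheeger_ratio [arg min_(A < [set vertex0 G]%SET |
    (0 < #|A|)%N && (#|A|%:R <= (nverts G)%:R / 2 :> R)%R) cheeger_ratio A]%O.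

(* [[set j; j]] is not an edge, so the diagonal vanishes; an edge [[set j; k]]
   forces [deg j > 0], so there is no division by zero. *)
Definition transition (G : graph) : 'M[R]_(nverts G) :=
  \matrix_(j, k) if [set j; k]%SET \in edges G then (deg j)%:R^-1 else 0.

Definition chi2 (G : graph) : R := (rev (spectrum (transition G)))`_1%N.

Definition classF (gamma : R) : set graph :=
  fun G => gamma * (nverts G)%:R <= lambda2 G.

Definition classC (gamma : R) : set graph :=
  fun G => gamma * (nverts G)%:R <= cheeger G.

Definition classM (gamma : R) : set graph :=
  fun G => gamma * (nverts G)%:R <= (min_deg G)%:R /\ gamma <= 1 - chi2 G.

End Spectral.

(* Main.v *)
From mathcomp Require Import classical_sets reals.
From mathcomp Require Import all_boot all_order all_algebra fingroup perm.
From mathcomp Require Import polyrcf complex spectral sesquilinear ring lra zify.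
Require Import Defs.

(* Each of the three conditions is a statement about quadratic forms.  Let
   E(x) be the sum of (x_j - x_k)^2 over the edges.  By the spectral theorem,
   lambda2 >= c iff E(x) >= c sum x_j^2 whenever sum x_j = 0, and (for positive
   degrees) 1 - chi2 >= c iff E(x) >= c sum d_j x_j^2 whenever
   sum d_j x_j = 0.  Both sums are least, among translates of x, when x is
   centred, so when all degrees lie between gamma n and n the two spectral gaps
   control each other.  Testing E on centred indicator functions bounds the
   Cheeger constant from below by lambda2 / 2, and singletons then bound the
   degrees.  Conversely, a Cheeger constant at least gamma n gives
   lambda2 >= gamma^2 n / 2: apply the coarea inequality to the squared positive
   and negative parts of x - m, where m is a median of x. *)

Set Implicit Arguments.
Unset Strict Implicit.
Unset Printing Implicit Defensive.

Import Order.TTheory GRing.Theory Num.Theory.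
Local Open Scope ring_scope.

(** * Spectra of real symmetric matrices *)

Lemma char_poly_similar (F : comNzRingType) (n : nat) (A V W : 'M[F]_n) :
  W *m V = 1%:M -> char_poly (W *m A *m V) = char_poly A.
Proof.
move=> WV; rewrite /char_poly.
have -> : char_poly_mx (W *m A *m V) =
    map_mx polyC W *m char_poly_mx A *m map_mx polyC V.
  rewrite /char_poly_mx mulmxBr mulmxBl !map_mxM/=; congr (_ - _).
  by rewrite mul_mx_scalar -scalemxAl -map_mxM WV map_mx1 scalemx1.
rewrite !det_mulmx mulrAC mulrC -det_mulmx.
by rewrite -map_mxM WV map_mx1 det1 mulr1.
Qed.

Section Spectrum.
Variable R : realType.

Lemma spectrum_sorted (n : nat) (A : 'M[R]_n) : sorted <=%R (spectrum A).
Proof.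
rewrite /spectrum (sorted_pairwise le_trans).
have : pairwise <%R (rootsR (char_poly A)).
  by rewrite -(sorted_pairwise lt_trans) sorted_roots.
elim: (rootsR _) => //= x r IH /andP[xr rs].
rewrite pairwise_cat IH // andbT; apply/andP; split; last first.
  by elim: (mup _ _) => //= k ->; rewrite all_nseq lexx orbT.
apply/allrelP => y z; rewrite mem_nseq => /andP[_ /eqP ->] /flattenP[_ /mapP[t tr ->]].
by rewrite mem_nseq => /andP[_ /eqP ->]; apply: ltW; apply: (allP xr).
Qed.

(** [spectrum] sees only real roots, so nothing is lost once the characteristic polynomial splits
    over [R]: a value occurs in either list as often as its multiplicity as a root. *)
Lemma spectrum_perm (n : nat) (A : 'M[R]_n) (s : seq R) :
  char_poly A = \prod_(x <- s) ('X - x%:P) -> perm_eq (spectrum A) s.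
Proof.
move=> As; apply/allP => x _ /=; apply/eqP; rewrite -[RHS](mu_prod_XsubC x s) -As.
have p0 : char_poly A != 0 by rewrite monic_neq0 // char_poly_monic.
rewrite /spectrum count_flatten -map_comp.
rewrite (eq_map (g := fun y => if y == x then mup x (char_poly A) else 0%N)); last first.
  by move=> y /=; rewrite count_nseq /=; case: eqP => [->|_]; rewrite ?mul1n.
have [xr|xr] := boolP (x \in rootsR (char_poly A)); last first.
  rewrite mupNroot; last first.
    by move: xr; rewrite -roots_on_rootsR //= in_itv.
  by rewrite sumnE big_map big1 // => y _; case: ifP.
rewrite sumnE big_map (bigD1_seq x) ?uniq_roots //= eqxx big1 ?addn0 //.
by move=> y /negPf ->.
Qed.

Local Notation Cr := (map_mx (real_complex R)).

Lemma Re_sum (I : finType) (F : I -> R[i]) :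
  complex.Re (\sum_i F i) = \sum_i complex.Re (F i).
Proof. by apply: (big_morph (@complex.Re R)) => [[x y] [z t]|]. Qed.

(* [a] and [b] are the real and imaginary parts of a unitary matrix whose rows
   are eigenvectors of [A]; [s] lists the eigenvalues. *)
Definition eigenframe (n : nat) (A : 'M[R]_n) (s : 'rV[R]_n) (a b : 'M[R]_n) :=
  [/\ a^T *m a + b^T *m b = 1%:M,
      a^T *m diag_mx s *m a + b^T *m diag_mx s *m b = A,
      forall i, (a *m a^T + b *m b^T) i i = 1 &
      forall i, (a *m A *m a^T + b *m A *m b^T) i i = s 0 i].

(** [A] is diagonalised as a complex Hermitian matrix. The eigenvalues are real but the eigenvectors
    need not be, so real and imaginary parts are kept side by side. The frame identities are real
    parts of U^* U = 1, A = U^* D U, and the diagonals of U U^* = 1 and U A U^* = D. *)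
Lemma symmetric_spectral (n : nat) (A : 'M[R]_n) : A^T = A ->
  exists (s : 'rV[R]_n) (a b : 'M[R]_n),
    char_poly A = \prod_i ('X - (s 0 i)%:P) /\ eigenframe A s a b.
Proof.
move=> symA; pose B : 'M[R[i]]_n := Cr A.
have Bherm : B \is hermsymmx.
  apply/is_hermitianmxP; rewrite expr0 scale1r; apply/matrixP => i j.
  by rewrite !mxE -[in RHS]symA mxE /= /Num.conj /= oppr0.
have Breal := hermitian_spectral_diag_real Bherm.
have /orthomx_spectralP Bs := hermitian_normalmx Bherm.
set U := spectralmx B in Bs; set d := spectral_diag B in Bs Breal.
have UU : U \is unitarymx by apply: spectral_unitarymx.
have Uu := unitarymx_unit UU.
pose s : 'rV[R]_n := map_mx (@complex.Re R) d.
have sd : d = Cr s.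
  apply/matrixP => i j; rewrite !mxE; apply/esym/RRe_real.
  by rewrite (mxOverP Breal).
exists s, (map_mx (@complex.Re R) U), (map_mx (@complex.Im R) U); split.
  apply: (map_poly_inj (real_complex R)).
  rewrite map_char_poly -/B Bs char_poly_similar ?mulVmx //.
  rewrite char_poly_trig ?diag_mx_is_trig // rmorph_prod /=.
  by apply: eq_bigr => i _; rewrite sd rmorphB /= map_polyX map_polyC /= !mxE eqxx.
have Ut := invmx_unitary UU.
have VU : (U^t*)%sesqui *m U = 1%:M by rewrite -Ut mulVmx.
have UV : U *m (U^t*)%sesqui = 1%:M by rewrite -Ut mulmxV.
rewrite Ut in Bs.
have UBV : U *m B *m (U^t*)%sesqui = diag_mx d.
  by rewrite Bs !mulmxA UV mul1mx -mulmxA UV mulmx1.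
split.
- apply/matrixP => j k; have /matrixP/(_ j k)/(congr1 (@complex.Re R)) := VU.
  rewrite !mxE Re_sum => E; transitivity (complex.Re ((j == k)%:R : R[i])); last first.
    by case: eqP.
  rewrite -E -big_split; apply: eq_bigr => i _ /=; rewrite !mxE.
  by case: (U i j) (U i k) => [x y] [z t] /=; rewrite mulNr opprK.
- apply/matrixP => j k; have /matrixP/(_ j k)/(congr1 (@complex.Re R)) := Bs.
  rewrite !mxE Re_sum /= => ->.
  rewrite -big_split; apply: eq_bigr => i _ /=.
  rewrite !mul_mx_diag !mxE sd !mxE.
  case: (U i j) (U i k) => [x y] [z t] /=; ring.
- move=> j; have /matrixP/(_ j j)/(congr1 (@complex.Re R)) := UV.
  rewrite !mxE Re_sum eqxx /= => <-.
  rewrite -big_split; apply: eq_bigr => i _ /=.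
  rewrite !mxE.
  case: (U j i) => [x y] /=; ring.
- move=> j; have /matrixP/(_ j j)/(congr1 (@complex.Re R)) := UBV.
  rewrite !mxE Re_sum eqxx /= => <-.
  rewrite -big_split; apply: eq_bigr => i _ /=.
  rewrite !mxE !mulr_suml Re_sum -big_split; apply: eq_bigr => k _ /=.
  rewrite !mxE.
  case: (U j i) (U j k) => [x y] [z t] /=; ring.
Qed.

End Spectrum.

(** * Rayleigh quotients and the second smallest eigenvalue *)

Section Rayleigh.
Variables (R : realType) (n : nat).
Implicit Types (x y u : 'rV[R]_n) (A B : 'M[R]_n).

Definition dot x y : R := (x *m y^T) 0 0.
Definition qform B x : R := (x *m B *m x^T) 0 0.

Lemma dotE x y : dot x y = \sum_i x 0 i * y 0 i.
Proof. by rewrite /dot mxE; apply: eq_bigr => i _; rewrite mxE. Qed.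

Lemma dotC x y : dot x y = dot y x.
Proof. by rewrite !dotE; apply: eq_bigr => i _; rewrite mulrC. Qed.

Lemma dot_ge0 x : 0 <= dot x x.
Proof. by rewrite dotE sumr_ge0 // => i _; rewrite -expr2 sqr_ge0. Qed.

Lemma dot_eq0 x : (dot x x == 0) = (x == 0).
Proof.
apply/eqP/eqP => [|->]; last by rewrite /dot mul0mx mxE.
rewrite dotE => /psumr_eq0P x0; apply/rowP => i; rewrite mxE.
have /eqP := x0 (fun j _ => ltac:(by rewrite -expr2 sqr_ge0)) i isT.
by rewrite -expr2 sqrf_eq0 => /eqP.
Qed.

Lemma dotZr (t : R) x y : dot x (t *: y) = t * dot x y.
Proof. by rewrite /dot linearZ /= -scalemxAr mxE. Qed.

Lemma dotBl x y z : dot (x - y) z = dot x z - dot y z.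
Proof. by rewrite /dot mulmxBl !mxE. Qed.

(** By symmetry [u] lies in both the left and the right kernel, so all terms containing it vanish.
    Hence projecting off [u] does not change the form. *)
Lemma qform_sub_ker B u x (t : R) : B^T = B -> u *m B = 0 ->
  qform B (x - t *: u) = qform B x.
Proof.
move=> symB uB; have Bu : B *m u^T = 0 by rewrite -symB -trmx_mul uB trmx0.
rewrite /qform mulmxBl -scalemxAl uB scaler0 subr0.
by rewrite linearB linearZ /= mulmxBr -scalemxAr -(mulmxA x B u^T) Bu mulmx0 scaler0 subr0.
Qed.

Definition ortho_part u x := x - (dot x u / dot u u) *: u.

Lemma dot_ortho_part u x : u != 0 -> dot (ortho_part u x) u = 0.
Proof.
move=> u0; rewrite dotBl (dotC (_ *: _)) dotZr divfK ?subrr //.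
by rewrite dot_eq0.
Qed.

Lemma dot_ortho_part2 u x : u != 0 ->
  dot (ortho_part u x) (ortho_part u x) = dot x x - dot x u ^+ 2 / dot u u.
Proof.
move=> u0; rewrite {2}/ortho_part dotC dotBl (dotC (_ *: _)) dotZr.
rewrite dot_ortho_part // mulr0 subr0 dotC dotBl (dotC (_ *: _)) dotZr.
by rewrite expr2 mulrAC.
Qed.

Section Frame.
Variables (B : 'M[R]_n) (s : 'rV[R]_n) (a b : 'M[R]_n).
Hypothesis frameB : eigenframe B s a b.

(** Squared modulus of the coefficient of [x] along the [i]-th complex eigenvector. *)
Definition weight x (i : 'I_n) := dot x (row i a) ^+ 2 + dot x (row i b) ^+ 2.

Lemma weight_ge0 x i : 0 <= weight x i.
Proof. by rewrite addr_ge0 ?sqr_ge0. Qed.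

(** A general diagonal [d] covers two cases: [d = 1] yields Parseval's identity, [d = s] the
    spectral expansion of the form. *)
Lemma frame_qform_diag (d : 'rV[R]_n) x :
  qform (a^T *m diag_mx d *m a + b^T *m diag_mx d *m b) x =
  \sum_i d 0 i * weight x i.
Proof.
have E (c : 'M[R]_n) : (x *m (c^T *m diag_mx d *m c) *m x^T) 0 0 =
    \sum_i d 0 i * dot x (row i c) ^+ 2.
  rewrite !mulmxA -mulmxA mxE; apply: eq_bigr => i _.
  have -> : (c *m x^T) i 0 = dot x (row i c).
    by rewrite dotC dotE mxE; apply: eq_bigr => j _; rewrite !mxE.
  have -> : (x *m c^T *m diag_mx d) 0 i = dot x (row i c) * d 0 i.
    rewrite mul_mx_diag mxE; congr (_ * _).
    by rewrite dotE mxE; apply: eq_bigr => j _; rewrite !mxE.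
  by rewrite expr2; ring.
rewrite /qform mulmxDr mulmxDl mxE !E -big_split /=.
by apply: eq_bigr => i _; rewrite -mulrDr.
Qed.

Lemma frame_dot x : dot x x = \sum_i weight x i.
Proof.
have [aabb _ _ _] := frameB.
have := frame_qform_diag (const_mx 1) x.
rewrite diag_const_mx !mulmx1 aabb /qform mulmx1 /dot => ->.
by apply: eq_bigr => i _; rewrite mxE mul1r.
Qed.

Lemma frame_qform x : qform B x = \sum_i s 0 i * weight x i.
Proof. by have [_ BE _ _] := frameB; rewrite -[in LHS]BE frame_qform_diag. Qed.

Lemma frame_norm i : dot (row i a) (row i a) + dot (row i b) (row i b) = 1.
Proof.
have [_ _ /(_ i) <- _] := frameB.
rewrite !mxE !dotE; congr (_ + _); apply: eq_bigr => j _; by rewrite !mxE.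
Qed.

Lemma frame_eigenvalue i : qform B (row i a) + qform B (row i b) = s 0 i.
Proof.
have [_ _ _ /(_ i) <-] := frameB.
have E (c : 'M[R]_n) : qform B (row i c) = (c *m B *m c^T) i i.
  by rewrite /qform -!row_mul !mxE; apply: eq_bigr => j _; rewrite !mxE.
by rewrite !E [RHS]mxE.
Qed.

Variables (u : 'rV[R]_n) (i0 i1 : 'I_n) (c : R).
Hypotheses (symB : B^T = B) (uB : u *m B = 0) (u0 : u != 0).
Hypotheses (i01 : i0 != i1) (c0 : 0 < c).
Hypotheses (s01 : s 0 i0 <= s 0 i1) (s1 : forall i, i != i0 -> s 0 i1 <= s 0 i).

Let uu_gt0 : 0 < dot u u.
Proof. by rewrite lt_def dot_eq0 u0 dot_ge0. Qed.

Let qform_u : qform B u = 0.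
Proof. by rewrite /qform uB mul0mx mxE. Qed.

(* With [e = u/|u|], the two lowest eigenvectors [v0], [v1] give
   [s0 + s1 >= c (2 - |<v0,e>|^2 - |<v1,e>|^2) >= c], while [s0 <= 0]
   because the form vanishes at [u]. *)
Lemma rayleigh_second_ge :
  (forall x, dot x u = 0 -> c * dot x x <= qform B x) -> c <= s 0 i1.
Proof.
move=> H.
have s0 : s 0 i0 <= 0.
  rewrite -(pmulr_lle0 _ uu_gt0) -qform_u frame_qform frame_dot mulr_sumr.
  apply: ler_sum => i _; rewrite ler_wpM2r ?weight_ge0 //.
  by have [->|/s1] := eqVneq i i0; [|apply: le_trans].
have K x : c * (dot x x - dot x u ^+ 2 / dot u u) <= qform B x.
  rewrite -(qform_sub_ker x (dot x u / dot u u) symB uB) -dot_ortho_part2 //.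
  exact/H/dot_ortho_part.
have L i : c * (1 - weight u i / dot u u) <= s 0 i.
  rewrite -frame_eigenvalue -(frame_norm i) /weight !(dotC u).
  by apply: le_trans (lerD (K _) (K _)); rewrite le_eqVlt; apply/orP; left; apply/eqP; ring.
(* Bessel's inequality for [u] and the two lowest eigenvectors. *)
have W : (weight u i0 + weight u i1) / dot u u <= 1.
  rewrite ler_pdivrMr // mul1r frame_dot (bigD1 i0) //= (bigD1 i1) 1?eq_sym //= lerD2l.
  by rewrite lerDl sumr_ge0 // => i _; rewrite weight_ge0.
have := lerD (L i0) (L i1); rewrite mulrDl in W.
move: (_ / dot u u) (_ / dot u u) W => q p W.
have : 0 <= c * (1 - (p + q)) by rewrite mulr_ge0 ?subr_ge0 // ltW.
lra.
Qed.

(* All the weight of [u] sits on the index [i0], so both parts of the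
   corresponding eigenvector are parallel to [u]. *)
Lemma rayleigh_second_le :
  (forall x, 0 <= qform B x) -> c <= s 0 i1 ->
  forall x, dot x u = 0 -> c * dot x x <= qform B x.
Proof.
move=> psd cs1 x xu.
have s_ge0 i : 0 <= s 0 i by rewrite -frame_eigenvalue addr_ge0.
(* [qform B u = 0] is a sum of nonnegative terms, and away from [i0] the eigenvalue is at least
   [c > 0], so the weight must vanish. *)
have wu i : i != i0 -> weight u i = 0.
  move=> ii0; have := qform_u; rewrite frame_qform => /psumr_eq0P.
  move=> /(_ (fun j _ => mulr_ge0 (s_ge0 j) (weight_ge0 u j)) i isT) /eqP.
  by rewrite mulf_eq0 gt_eqF /= => [/eqP//|]; apply: lt_le_trans (s1 ii0); apply: lt_le_trans cs1.
have wu0 : weight u i0 = dot u u.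
  by rewrite frame_dot (bigD1 i0) //= big1 ?addr0.
(* Equality case of Cauchy-Schwarz: a unit eigenvector that carries the whole norm of [u] has no
   component orthogonal to [u]. *)
have par : dot (ortho_part u (row i0 a)) (ortho_part u (row i0 a)) +
           dot (ortho_part u (row i0 b)) (ortho_part u (row i0 b)) = 0.
  rewrite !dot_ortho_part2 // addrACA frame_norm -opprD -mulrDl.
  by rewrite !(dotC _ u) -/(weight u i0) wu0 divff ?subrr // gt_eqF.
move/eqP: par; rewrite paddr_eq0 ?dot_ge0 // !dot_eq0 !subr_eq0 => /andP[/eqP pa /eqP pb].
have wx : weight x i0 = 0.
  by rewrite /weight pa pb !dotZr xu !mulr0 expr0n addr0.
rewrite frame_dot frame_qform mulr_sumr; apply: ler_sum => i _.
have [->|ii0] := eqVneq i i0; first by rewrite wx !mulr0.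
by rewrite ler_wpM2r ?weight_ge0 // (le_trans cs1) ?s1.
Qed.

End Frame.
End Rayleigh.

Lemma spectrum_indices (R : realType) (n : nat) (A : 'M[R]_n) (s : 'rV[R]_n) :
  char_poly A = \prod_i ('X - (s 0 i)%:P) ->
  size (spectrum A) = n /\
  exists p : 'S_n, forall i : 'I_n, (spectrum A)`_i = s 0 (p i).
Proof.
move=> As.
have sp : perm_eq (spectrum A) [tuple s 0 i | i < n].
  by apply: spectrum_perm; rewrite As big_map big_enum.
have sz : size (spectrum A) = n by rewrite (perm_size sp) size_tuple.
split=> //.
have /tuple_permP[p E] : perm_eq (Tuple (introT eqP sz)) [tuple s 0 i | i < n] by [].
exists p => i; rewrite -[spectrum A]/(tval (Tuple (introT eqP sz))) E.
by rewrite -tnth_nth !tnth_mktuple.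
Qed.

(** The frame comes in no particular order; [p] translates a rank in the sorted spectrum into a
    frame index. *)
Lemma symmetric_spectrum (R : realType) (n : nat) (A : 'M[R]_n) : A^T = A ->
  size (spectrum A) = n /\
  exists (s : 'rV[R]_n) (a b : 'M[R]_n) (p : 'S_n),
    [/\ eigenframe A s a b,
        forall i : 'I_n, (spectrum A)`_i = s 0 (p i) &
        forall i j : 'I_n, (i <= j)%N -> s 0 (p i) <= s 0 (p j)].
Proof.
move=> symA; have [s [a [b [As fr]]]] := symmetric_spectral symA.
have [sz [p pE]] := spectrum_indices As; split=> //.
exists s, a, b, p; split=> // i j ij; rewrite -!pE.
apply: (sorted_leq_nth le_trans le_refl) => //; first exact: spectrum_sorted.
- by rewrite inE sz ltn_ord.
- by rewrite inE sz ltn_ord.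
Qed.

(** * Edge counting, Dirichlet energy and the Laplacian *)

Section Graph.
Variable G : graph.
Local Notation n := (nverts G).
Implicit Types (j k : 'I_n) (A : {set 'I_n}).

Definition adj j k := [set j; k] \in edges G.

Lemma adjC j k : adj j k = adj k j.
Proof. by rewrite /adj setUC. Qed.

Lemma adj_irrefl j : adj j j = false.
Proof. by apply/negP => /edges_card2; rewrite setUid cards1. Qed.

Lemma adj_neq j k : adj j k -> j != k.
Proof. by apply: contraTneq => ->; rewrite adj_irrefl. Qed.

Lemma deg_adj j : deg j = (\sum_k adj j k)%N.
Proof.
have -> : (\sum_k adj j k)%N = #|[set k | adj j k]|.
  by rewrite -sum1dep_card [RHS]big_mkcond; apply: eq_bigr => k _; case: adj.
rewrite -(card_in_imset (f := fun k => [set j; k])); last first.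
  move=> k l; rewrite !inE => jk jl /setP/(_ k); rewrite !inE eqxx orbT.
  by rewrite eq_sym (negPf (adj_neq jk)) => /esym/eqP.
congr #|pred_of_set _|; apply/setP => e; rewrite inE; apply/andP/imsetP => [[eE je]|[k]].
  have /eqP/cards2P[v [w [vw ev]]] := edges_card2 eE.
  move: eE je; rewrite ev !inE => eE /orP[] /eqP ->.
    by exists w; rewrite ?inE.
  by exists v; rewrite ?inE /adj setUC.
by rewrite inE => jk ->; split=> //; rewrite !inE eqxx.
Qed.

(** A boundary edge has one endpoint inside [A] and one outside. Writing the inner one first orients
    it uniquely, which makes the map from ordered pairs to edges injective. *)
Lemma boundary_adj A :
  #|boundary A| = (\sum_(j in A) \sum_(k in ~: A) adj j k)%N.
Proof.
pose S := [set p : 'I_n * 'I_n | [&& p.1 \in A, p.2 \notin A & adj p.1 p.2]].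
have -> : (\sum_(j in A) \sum_(k in ~: A) adj j k)%N = #|S|.
  rewrite pair_big -sum1dep_card [RHS]big_mkcond [LHS]big_mkcond.
  apply: eq_bigr => -[j k] _ /=; rewrite inE.
  by case: (j \in A) (k \in A) (adj j k) => [] [] [].
rewrite -(card_in_imset (f := fun p : 'I_n * 'I_n => [set p.1; p.2])); last first.
  move=> [j k] [j' k']; rewrite !inE /= => /and3P[jA kA _] /and3P[jA' kA' _] E.
  have /setP/(_ j) := E; rewrite !inE eqxx /= => /esym/orP[/eqP->|/eqP jk']; last first.
    by rewrite -jk' jA in kA'.
  have /setP/(_ k) := E; rewrite !inE eqxx orbT /= => /esym/orP[/eqP kj'|/eqP->//].
  by rewrite kj' jA' in kA.
congr #|pred_of_set _|; apply/setP => e; rewrite inE.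
apply/andP/imsetP => [[eE eA]|[[j k]]]; last first.
  rewrite inE /= => /and3P[jA kA jk] ->; split=> //.
  have -> : [set j; k] :&: A = [set j]; last by rewrite cards1.
  apply/setP => i; rewrite !inE; have [->|_] := eqVneq i j; first by rewrite jA.
  by have [->|] := eqVneq i k; rewrite ?(negPf kA).
have /eqP/cards2P[v [w [vw ev]]] := edges_card2 eE; rewrite ev in eE eA *.
have [vA|vA] := boolP (v \in A); have [wA|wA] := boolP (w \in A).
- move: eA; rewrite (setIidPl _) ?cards2 ?vw //.
  by apply/subsetP => i; rewrite !inE => /orP[] /eqP ->.
- by exists (v, w); rewrite ?inE /= ?vA ?wA.
- by exists (w, v); rewrite /= 1?setUC // inE /= vA wA adjC.
- move: eA; have -> : [set v; w] :&: A = set0; last by rewrite cards0.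
  apply/setP => i; rewrite !inE; apply/negP => /andP[/orP[] /eqP ->].
    by apply/negP.
  by apply/negP.
Qed.

Lemma deg_le_nverts j : (deg j <= n)%N.
Proof.
rewrite deg_adj -[leqRHS]card_ord -sum1_card.
by apply: leq_sum => k _; apply: leq_b1.
Qed.

Variable R : realType.
Implicit Types (x y : 'I_n -> R) (c : R).

(* Summing over ordered pairs counts every edge twice. *)
Definition energy x : R :=
  2^-1 * \sum_j \sum_k (adj j k)%:R * (x j - x k) ^+ 2.

Lemma eq_energy x y : x =1 y -> energy x = energy y.
Proof.
by move=> xy; congr (_ * _); do 2!apply: eq_bigr => ? _; rewrite !xy.
Qed.

Lemma energy_ge0 x : 0 <= energy x.
Proof.
rewrite mulr_ge0 ?invr_ge0 ?ler0n //; do 2!apply: sumr_ge0 => ? _.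
by rewrite mulr_ge0 ?ler0n ?sqr_ge0.
Qed.

Lemma deg_natr j : (deg j)%:R = \sum_k (adj j k)%:R :> R.
Proof. by rewrite deg_adj natr_sum. Qed.

Lemma sum_deg (f : 'I_n -> R) :
  \sum_j (deg j)%:R * f j = \sum_j \sum_k (adj j k)%:R * f j.
Proof. by apply: eq_bigr => j _; rewrite deg_natr mulr_suml. Qed.

Lemma energyE x : energy x =
  \sum_j (deg j)%:R * x j ^+ 2 - \sum_j \sum_k (adj j k)%:R * (x j * x k).
Proof.
have S : \sum_j \sum_k (adj j k)%:R * x k ^+ 2 = \sum_j (deg j)%:R * x j ^+ 2.
  rewrite exchange_big sum_deg; apply: eq_bigr => j _; apply: eq_bigr => k _ /=.
  by rewrite adjC.
rewrite /energy; set T := \sum_j \sum_k _ * (x j * x k).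
have -> : \sum_j \sum_k (adj j k)%:R * (x j - x k) ^+ 2 =
    \sum_j (deg j)%:R * x j ^+ 2 + \sum_j (deg j)%:R * x j ^+ 2 - T *+ 2.
  rewrite -{1}S sum_deg -sumrMnl -big_split -sumrB; apply: eq_bigr => j _ /=.
  rewrite -sumrMnl -big_split -sumrB; apply: eq_bigr => k _ /=; ring.
by field.
Qed.

(** Keeping [y] apart from [x] lets one computation serve both the Laplacian, where they agree, and
    the normalised Laplacian, where [y] is [x] rescaled by square roots of degrees. *)
Lemma qform_energy (B : 'M[R]_n) (y : 'rV[R]_n) x :
  (forall j k, y 0 j * B j k * y 0 k =
    (j == k)%:R * ((deg j)%:R * x j ^+ 2) - (adj j k)%:R * (x j * x k)) ->
  qform B y = energy x.
Proof.
move=> yB; rewrite energyE /qform mxE exchange_big -sumrB; apply: eq_bigr => k _ /=.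
rewrite !mxE mulr_suml.
rewrite (eq_bigr _ (fun j _ => yB j k)).
rewrite sumrB (bigD1 k) //= eqxx mul1r big1 ?addr0 => [|j /negPf ->]; last first.
  by rewrite mul0r.
by congr (_ - _); apply: eq_bigr => j _.
Qed.

Lemma laplacianE j k :
  laplacian R G j k = (j == k)%:R * (deg k)%:R - (adj j k)%:R.
Proof.
rewrite mxE -/(adj j k); have [->|_] := eqVneq j k.
  by rewrite adj_irrefl mul1r subr0.
by rewrite mul0r sub0r; case: adj; rewrite ?oppr0.
Qed.

Lemma laplacian_sym : (laplacian R G)^T = laplacian R G.
Proof.
apply/matrixP => j k; rewrite mxE !laplacianE adjC eq_sym.
by have [->|_] := eqVneq j k; rewrite ?mul0r.
Qed.

Lemma qform_laplacian (y : 'rV[R]_n) : qform (laplacian R G) y = energy (y 0).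
Proof.
apply: qform_energy => j k; rewrite laplacianE.
have [->|_] := eqVneq j k; rewrite ?mulr1n ?mulr0n; last by ring.
by ring.
Qed.

Lemma laplacian_ker : const_mx 1 *m laplacian R G = 0 :> 'rV[R]_n.
Proof.
apply/rowP => k; rewrite !mxE.
under eq_bigr => j _ do rewrite laplacianE mxE mul1r.
rewrite sumrB (bigD1 k) //= eqxx mul1r big1 ?addr0 => [|j /negPf ->]; last first.
  by rewrite mul0r.
apply/eqP; rewrite subr_eq0 deg_natr; apply/eqP; apply: eq_bigr => j _.
by rewrite adjC.
Qed.

Lemma dot_row_const1 (y : 'rV[R]_n) : dot y (const_mx 1) = \sum_j y 0 j.
Proof. by rewrite dotE; apply: eq_bigr => j _; rewrite mxE mulr1. Qed.

Lemma dot_sqr (y : 'rV[R]_n) : dot y y = \sum_j y 0 j ^+ 2.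
Proof. by rewrite dotE; apply: eq_bigr => j _; rewrite expr2. Qed.

(** Constants span the kernel direction [u] of the Rayleigh lemmas, and orthogonality to them is the
    condition of zero sum. *)
Lemma lambda2_rayleigh c : 0 < c ->
  (c <= lambda2 R G <->
   forall x, \sum_j x j = 0 -> c * \sum_j x j ^+ 2 <= energy x).
Proof.
move=> c0.
have [_ [s [a [b [p [fr pE srt]]]]]] := symmetric_spectrum laplacian_sym.
pose o0 := vertex0 G; pose o1 := Ordinal (nverts_ge2 G).
have l2 : lambda2 R G = s 0 (p o1) by rewrite -pE.
have i01 : p o0 != p o1 by rewrite (inj_eq perm_inj).
have s1 i : i != p o0 -> s 0 (p o1) <= s 0 i.
  rewrite -{1 2}(permKV p i) (inj_eq perm_inj) => ni; apply: srt.
  by rewrite lt0n; apply: contraNneq ni => i0; apply/eqP/val_inj.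
have u0 : const_mx 1 != 0 :> 'rV[R]_n.
  by apply/eqP => /rowP/(_ o0)/eqP; rewrite !mxE oner_eq0.
have psd (y : 'rV[R]_n) : 0 <= qform (laplacian R G) y.
  by rewrite qform_laplacian energy_ge0.
rewrite l2; split=> [cs x x0|H].
  have xE : (\row_j x j) 0 =1 x by move=> j; rewrite mxE.
  have := rayleigh_second_le fr laplacian_ker u0 c0 s1 psd cs (x := \row_j x j).
  rewrite qform_laplacian dot_row_const1 dot_sqr (eq_energy xE).
  rewrite (eq_bigr _ (fun j _ => xE j)).
  by rewrite [X in c * X](eq_bigr (fun j => x j ^+ 2)) => [|j _]; [exact|rewrite xE].
apply: (rayleigh_second_ge fr laplacian_sym laplacian_ker u0 i01 c0 _ s1) => [|y].
  exact: srt.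
by rewrite qform_laplacian dot_row_const1 dot_sqr; apply: H.
Qed.

(** * The random walk and its normalised Laplacian *)

Section Chi2.
Hypothesis deg_gt0 : forall j, (0 < deg j)%N.

Let r j : R := Num.sqrt (deg j)%:R.

Let r_gt0 j : 0 < r j.
Proof. by rewrite sqrtr_gt0 ltr0n. Qed.

Let r_neq0 j : r j != 0.
Proof. by rewrite gt_eqF. Qed.

Let r2 j : r j ^+ 2 = (deg j)%:R.
Proof. by rewrite sqr_sqrtr ?ler0n. Qed.

(** The normalised adjacency matrix D^{-1/2} A D^{-1/2}. Unlike [transition] it is symmetric, and
    the two are conjugate by D^{1/2}. *)
Let N : 'M[R]_n := \matrix_(j, k) ((adj j k)%:R / (r j * r k)).

Let N_sym : N^T = N.
Proof. by apply/matrixP => j k; rewrite !mxE adjC mulrC (mulrC (r j)) mulrC. Qed.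

Let spectrum_transition : spectrum (transition R G) = spectrum N.
Proof.
suff P : char_poly (transition R G) = char_poly N by rewrite /spectrum P.
pose V : 'M[R]_n := diag_mx (\row_j r j).
pose W : 'M[R]_n := diag_mx (\row_j (r j)^-1).
rewrite -(char_poly_similar N (W := W) (V := V)).
  congr char_poly; apply/matrixP => j k; rewrite mul_mx_diag mul_diag_mx !mxE -/(adj j k).
  rewrite -r2; case: adj; rewrite /= ?mul0r ?mulr0 ?mul0r //.
  by field; rewrite !r_neq0.
rewrite mulmx_diag; apply/matrixP => j k; rewrite !mxE.
by rewrite mulVf ?r_neq0.
Qed.

(** Replacing N by 1 - N keeps the eigenvectors and reverses the order of the eigenvalues, so the
    second largest becomes the second smallest. *)
Let frame_compl s a b :
  eigenframe N s a b -> eigenframe (1%:M - N) (const_mx 1 - s) a b.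
Proof.
move=> [e1 e2 e3 e4]; split=> //.
- rewrite linearB /= diag_const_mx !mulmxBr !mulmxBl !mulmx1 addrACA -opprD.
  by rewrite e1 e2.
- move=> i; rewrite !mulmxBr !mulmxBl !mulmx1 addrACA -opprD.
  by rewrite mxE [in X in _ + X]mxE e3 e4 !mxE.
Qed.

(** Under y_j = sqrt(d_j) x_j the form of 1 - N becomes the energy, the square norm becomes
    degree-weighted, and orthogonality to the kernel vector sqrt(d_j) becomes the weighted centring
    of [x]. *)
Lemma chi2_rayleigh c : 0 < c ->
  (c <= 1 - chi2 R G <->
   forall x, \sum_j (deg j)%:R * x j = 0 ->
     c * \sum_j (deg j)%:R * x j ^+ 2 <= energy x).
Proof.
move=> c0; set L : 'M[R]_n := 1%:M - N; pose u : 'rV[R]_n := \row_j r j.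
have [sz [t [a [b [p [frN pE srt]]]]]] := symmetric_spectrum N_sym.
have fr := frame_compl frN.
have L_sym : L^T = L by rewrite linearB /= trmx1 N_sym.
have LE (y : 'rV[R]_n) x : (forall j, y 0 j = r j * x j) -> qform L y = energy x.
  move=> yx; apply: qform_energy => j k; rewrite !mxE !yx -r2.
  have [->|_] := eqVneq j k; rewrite ?mulr1n ?mulr0n.
    by field; rewrite r_neq0.
  by field; rewrite !r_neq0.
have uL : u *m L = 0.
  rewrite mulmxBr mulmx1; apply/rowP => k; rewrite !mxE.
  apply/eqP; rewrite subr_eq0; apply/eqP.
  transitivity ((deg k)%:R / r k); first by rewrite -r2; field.
  rewrite deg_natr mulr_suml; apply: eq_bigr => j _; rewrite !mxE adjC.
  by field; rewrite !r_neq0.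
(* Counting from 0, ranks n - 1 and n - 2 hold the two largest eigenvalues of [N]; index 1 of the
   reversed list is rank n - 2. *)
have n1 : (n.-1 < n)%N by rewrite prednK ?leqnn // (ltnW (nverts_ge2 G)).
have n2 : (n.-2 < n)%N by rewrite (leq_ltn_trans (leq_pred _)).
pose o0 := Ordinal n1; pose o1 := Ordinal n2.
have l2 : chi2 R G = t 0 (p o1).
  rewrite -pE /chi2 spectrum_transition nth_rev ?sz ?nverts_ge2 //=.
  by rewrite -subn2.
have i01 : p o0 != p o1.
  rewrite (inj_eq perm_inj) -val_eqE /=.
  by have := nverts_ge2 G; lia.
have s1 i : i != p o0 -> (const_mx 1 - t) 0 (p o1) <= (const_mx 1 - t) 0 i.
  rewrite -{1 2}(permKV p i) (inj_eq perm_inj) => ni; rewrite !mxE lerD2l lerN2.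
  apply: srt => /=; move: ni (ltn_ord (p^-1%g i)); rewrite -val_eqE /=.
  by have := nverts_ge2 G; lia.
have s01 : (const_mx 1 - t) 0 (p o0) <= (const_mx 1 - t) 0 (p o1).
  by rewrite !mxE lerD2l lerN2 srt //= leq_pred.
have u0 : u != 0.
  by apply/eqP => /rowP/(_ o0)/eqP; rewrite !mxE (negPf (r_neq0 _)).
have -> : 1 - chi2 R G = (const_mx 1 - t) 0 (p o1) by rewrite l2 !mxE.
have yK (y : 'rV[R]_n) j : y 0 j = r j * (y 0 j / r j) by field; rewrite r_neq0.
have dotu (y : 'rV[R]_n) x : (forall j, y 0 j = r j * x j) ->
    dot y u = \sum_j (deg j)%:R * x j.
  by move=> yx; rewrite dotE; apply: eq_bigr => j _; rewrite yx mxE -r2; ring.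
have dot2 (y : 'rV[R]_n) x : (forall j, y 0 j = r j * x j) ->
    dot y y = \sum_j (deg j)%:R * x j ^+ 2.
  by move=> yx; rewrite dot_sqr; apply: eq_bigr => j _; rewrite yx -r2; ring.
split=> [cs x x0|H].
  have xE j : (\row_j (r j * x j)) 0 j = r j * x j by rewrite mxE.
  rewrite -(LE _ _ xE) -(dot2 _ _ xE).
  apply: (rayleigh_second_le fr uL u0 c0 s1 _ cs); last by rewrite (dotu _ _ xE).
  by move=> y; rewrite (LE _ _ (yK y)) energy_ge0.
apply: (rayleigh_second_ge fr L_sym uL u0 i01 c0 s01 s1) => y.
by rewrite (LE _ _ (yK y)) (dotu _ _ (yK y)) (dot2 _ _ (yK y)); apply: H.
Qed.

End Chi2.

End Graph.

(** * Cheeger's inequality and comparison of the three conditions *)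

Section Comparison.
Variables (R : realType) (G : graph).
Local Notation n := (nverts G).
Implicit Types (j k : 'I_n) (A : {set 'I_n}) (x f : 'I_n -> R) (c g h : R).

Lemma nverts_gt0 : 0 < n%:R :> R.
Proof. by rewrite ltr0n (ltnW (nverts_ge2 G)). Qed.

Lemma half_nvertsE A : (#|A|%:R <= n%:R / 2 :> R) = (#|A|.*2 <= n)%N.
Proof. by rewrite ler_pdivlMr ?ltr0n // -natrM ler_nat muln2. Qed.

Lemma cheegerP c : c <= cheeger R G <->
  forall A, (0 < #|A|)%N -> (#|A|.*2 <= n)%N -> c * #|A|%:R <= #|boundary A|%:R.
Proof.
rewrite /cheeger; case: arg_minP => [|A].
  by rewrite half_nvertsE !cards1 /= nverts_ge2.
rewrite half_nvertsE => /andP[A0 An] Amin; split=> [cA B B0 Bn|]; last first.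
  by move=> H; rewrite /cheeger_ratio ler_pdivlMr ?ltr0n ?H.
rewrite -ler_pdivlMr ?ltr0n //; apply: le_trans cA _.
by apply: Amin; rewrite half_nvertsE B0.
Qed.

Lemma min_degP c : c <= (min_deg G)%:R <-> forall j, c <= (deg j)%:R.
Proof.
rewrite /min_deg; case: arg_minnP => // i _ imin; split=> [ci j|//].
by apply: le_trans ci _; rewrite ler_nat imin.
Qed.

(** The l^1 counterpart of [energy]; again the factor 1/2 undoes the double count of edges. *)
Definition variation f : R :=
  2^-1 * \sum_j \sum_k (adj j k)%:R * `|f j - f k|.

Lemma variation_ge0 f : 0 <= variation f.
Proof.
rewrite mulr_ge0 ?invr_ge0 ?ler0n //; do 2!apply: sumr_ge0 => ? _.
by rewrite mulr_ge0 ?ler0n.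
Qed.

Definition indic A : 'I_n -> R := fun j => (j \in A)%:R.

Lemma sum_indic A : \sum_j indic A j = #|A|%:R.
Proof.
rewrite -sum1_card natr_sum [RHS]big_mkcond; apply: eq_bigr => j _.
by rewrite /indic; case: (j \in A).
Qed.

Lemma variation_indic A : variation (indic A) = #|boundary A|%:R.
Proof.
have bE : #|boundary A|%:R =
    \sum_j \sum_k (adj j k)%:R * (indic A j * (1 - indic A k)).
  rewrite boundary_adj natr_sum big_mkcond; apply: eq_bigr => j _.
  rewrite /indic; case: (j \in A); last by rewrite big1 // => k _; rewrite mul0r mulr0.
  rewrite natr_sum big_mkcond; apply: eq_bigr => k _; rewrite inE.
  by case: (k \in A); rewrite /= ?subrr ?subr0 !(mulr0, mulr1).
have bE' : #|boundary A|%:R =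
    \sum_j \sum_k (adj j k)%:R * (indic A k * (1 - indic A j)).
  by rewrite bE exchange_big; do 2!apply: eq_bigr => ? _; rewrite adjC.
rewrite /variation; apply: (canLR (mulKf _)); first by rewrite pnatr_eq0.
rewrite mulr_natl mulr2n {1}bE bE' -big_split; apply: eq_bigr => j _ /=.
rewrite -big_split; apply: eq_bigr => k _ /=; rewrite -mulrDr; congr (_ * _).
rewrite /indic; case: (j \in A) (k \in A) => [] [] /=;
  by rewrite !(subrr, subr0, mul0r, mulr0, mulr1, add0r, addr0, normr0, normr1, sub0r, normrN).
Qed.

Lemma energy_indic A : energy (indic A) = #|boundary A|%:R.
Proof.
rewrite -variation_indic; congr (_ * _); do 2!apply: eq_bigr => ? _; congr (_ * _).
rewrite /indic; do 2!case: (_ \in A);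
  by rewrite !(subrr, subr0, sub0r, sqrrN, expr1n, expr0n, normrN, normr0, normr1).
Qed.

Lemma energy_shift x (m : R) : energy (fun j => x j - m) = energy x.
Proof.
by congr (_ * _); do 2!apply: eq_bigr => ? _; congr (_ * _ ^+ 2); ring.
Qed.

(** In the expanded square the cross term vanishes by centring and the term in m^2 is nonnegative.
    It is applied with unit weights and with degrees. *)
Lemma sum_sqr_shift (w x : 'I_n -> R) (m : R) : (forall j, 0 <= w j) ->
  \sum_j w j * x j = 0 ->
  \sum_j w j * x j ^+ 2 <= \sum_j w j * (x j - m) ^+ 2.
Proof.
move=> w0 wx.
have -> : \sum_j w j * (x j - m) ^+ 2 = \sum_j w j * x j ^+ 2
    - (2 * m) * (\sum_j w j * x j) + \sum_j w j * m ^+ 2.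
  rewrite mulr_sumr -sumrB -big_split; apply: eq_bigr => j _ /=; ring.
by rewrite wx mulr0 subr0 lerDl sumr_ge0 // => j _; rewrite mulr_ge0 ?sqr_ge0.
Qed.

(* Peel off the level sets of [f] one at a time, from the bottom: subtracting
   the least positive value on the support lowers both sides accordingly. *)
Lemma coarea h f :
  (forall A, (0 < #|A|)%N -> (#|A|.*2 <= n)%N -> h * #|A|%:R <= #|boundary A|%:R) ->
  (forall j, 0 <= f j) -> (#|[set j | f j != 0%R]|.*2 <= n)%N ->
  h * \sum_j f j <= variation f.
Proof.
move=> hA; have [m] := ubnP #|[set j | f j != 0]|.
elim: m f => // m IH f; set A := [set j | f j != 0] => Am f0 An.
have fA j : j \notin A -> f j = 0 by rewrite inE negbK => /eqP.
have [A0|[i iA]] := set_0Vmem A.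
  rewrite big1 ?mulr0 ?variation_ge0 // => j _; apply: fA; by rewrite A0 inE.
case: (@arg_minP _ _ _ i (fun j => j \in A) f iA) => {iA}i /= iA imin.
pose t := f i; pose f' j := f j - t * indic A j.
have f'0 j : 0 <= f' j.
  rewrite /f' /indic; case: (boolP (j \in A)) => jA; last by rewrite mulr0 subr0.
  by rewrite mulr1 subr_ge0 imin.
have sub : [set j | f' j != 0] \proper A.
  apply/properP; split; last first.
    by exists i; rewrite // inE /f' /indic iA mulr1 subrr eqxx.
  apply/subsetP => j; rewrite inE; apply: contraR => jA.
  by rewrite /f' /indic (negPf jA) (fA _ jA) mulr0 subrr.
have t0 : 0 <= t by apply: f0.
have IHf := IH f' (leq_trans (proper_card sub) Am) f'0.
have {}IHf : h * \sum_j f' j <= variation f'.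
  by apply: IHf; rewrite (leq_trans _ An) // leq_double ltnW ?proper_card.
have A0 : (0 < #|A|)%N by apply/card_gt0P; exists i.
have -> : \sum_j f j = \sum_j f' j + t * #|A|%:R.
  rewrite -sum_indic mulr_sumr -big_split; apply: eq_bigr => j _.
  by rewrite /= /f' subrK.
(* Variation is additive here. Inside [A] the constant [t] cancels in differences; across the
   boundary [f'] and the indicator are both nonnegative and vanish outside [A], so their jumps have
   the same sign. *)
have -> : variation f = variation f' + t * variation (indic A).
  rewrite /variation mulrCA -mulrDr; congr (_ * _).
  rewrite mulr_sumr -big_split; apply: eq_bigr => j _ /=.
  rewrite mulr_sumr -big_split; apply: eq_bigr => k _ /=.
  rewrite mulrCA -mulrDr; congr (_ * _).
  move: (f'0 j) (f'0 k) (fA j) (fA k); rewrite /f' /indic.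
  case: (j \in A) (k \in A) => [] [] /=; rewrite !(mulr1, mulr0, subr0) => fj fk.
  - by rewrite subrr normr0 mulr0 addr0 => _ _; congr `|_|; ring.
  - by move=> _ ->//; rewrite !subr0 normr1 mulr1 !ger0_norm ?subrK.
  - by move=> ->// _; rewrite !sub0r !normrN normr1 mulr1 !ger0_norm ?subrK.
  - by move=> -> // ->//; rewrite !subr0 normr0 mulr0 addr0.
rewrite mulrDr lerD // mulrCA ler_wpM2l // variation_indic.
exact: hA.
Qed.

(** The median is taken as the least value that at most half of the vertices exceed. *)
Lemma median_exists x : exists m : R,
  (#|[set j | (m < x j)%R]|.*2 <= n)%N /\ (#|[set j | (x j < m)%R]|.*2 <= n)%N.
Proof.
pose P i := (#|[set j | (x i < x j)%R]|.*2 <= n)%N.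
case: (@arg_maxP _ _ _ (vertex0 G) xpredT x isT) => i _ imax.
have Pi : P i.
  rewrite /P (_ : [set j | _] = set0) ?cards0 //.
  by apply/setP => j; rewrite !inE; apply/negbTE; rewrite -leNgt; exact: imax.
case: (@arg_minP _ _ _ i P x Pi) => {imax Pi}i Pi imin.
exists (x i); split=> //.
set S := [set j | x j < x i]; rewrite leqNgt; apply/negP => Sn.
have /card_gt0P[k0 k0S] : (0 < #|S|)%N by case: #|S| Sn.
(* [x k] is the largest value below the candidate. By minimality more than half of the vertices
   exceed it; they are disjoint from [S], itself assumed to hold more than half. *)
case: (@arg_maxP _ _ _ k0 (fun j => j \in S) x k0S) => k /= kS kmax.
have kP : ~~ P k.
  by apply/negP => /imin; rewrite leNgt; move: kS; rewrite inE => ->.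
rewrite /P -ltnNge in kP.
have : [disjoint S & [set j | x k < x j]].
  by rewrite disjoints_subset; apply/subsetP => j /kmax; rewrite !inE -leNgt.
rewrite -leq_card_setU => /eqP U.
have := max_card (S :|: [set j | x k < x j]); rewrite card_ord {}U.
by move: #|S| #|_| Sn kP => s1 s2; lia.
Qed.

(* Positive and negative parts, squared, followed by AM-GM
   [|d| w <= d^2/g + (g/4) w^2] with [w = |a| + |b|]. *)
Lemma sqr_parts_variation g (a b : R) : 0 < g ->
  `|Num.max 0 a ^+ 2 - Num.max 0 b ^+ 2|
    + `|Num.max 0 (- a) ^+ 2 - Num.max 0 (- b) ^+ 2|
  <= (a - b) ^+ 2 / g + g / 2 * (a ^+ 2 + b ^+ 2).
Proof.
(* Each difference of squares factors; taking positive parts is 1-Lipschitz, and the two parts of a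
   number add up to its absolute value. *)
move=> g0; apply: (@le_trans _ _ (`|a - b| * (`|a| + `|b|))).
  have lip (u v : R) : `|Num.max 0 u - Num.max 0 v| <= `|u - v|.
    rewrite ler_norml; have := ler_norm (u - v); have := ler_norm (v - u).
    rewrite (distrC v); move: `|u - v| => d vu uv.
    by have [u0|u0] := leP 0 u; have [v0|v0] := leP 0 v; apply/andP; split; lra.
  have norm_max (t : R) : `|t| = Num.max 0 t + Num.max 0 (- t).
    have [t0|t0] := leP 0 t; first by rewrite ger0_norm // max_l ?oppr_le0 // addr0.
    by rewrite ltr0_norm // max_r ?add0r // oppr_ge0 ltW.
  have max0 (t : R) : 0 <= Num.max 0 t by rewrite le_max lexx.
  rewrite (norm_max a) (norm_max b) !subr_sqr !normrM !(ger0_norm (addr_ge0 (max0 _) (max0 _))).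
  apply: le_trans (lerD (ler_wpM2r _ (lip _ _)) (ler_wpM2r _ (lip _ _))) _;
    rewrite ?addr_ge0 //.
  have -> : - a - - b = b - a by ring.
  by rewrite (distrC b); lra.
set d := `|a - b|; set w := _ + _.
have wle : w ^+ 2 <= 2 * (a ^+ 2 + b ^+ 2).
  rewrite -(real_normK (num_real a)) -(real_normK (num_real b)) /w.
  by have := sqr_ge0 (`|a| - `|b|); lra.
rewrite -(real_normK (num_real (a - b))) -/d.
have g4 : 0 <= g / 4 by rewrite divr_ge0 ?ltW.
apply: (@le_trans _ _ (d ^+ 2 / g + g / 4 * w ^+ 2)); last first.
  by rewrite lerD2l; have := ler_wpM2l g4 wle; lra.
rewrite -subr_ge0.
have -> : d ^+ 2 / g + g / 4 * w ^+ 2 - d * w = g^-1 * (d - g / 2 * w) ^+ 2.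
  by field; rewrite gt_eqF.
by rewrite mulr_ge0 ?sqr_ge0 // invr_ge0 ltW.
Qed.

(** With Y the sum of squares about a median, both parts have support on at most half of the
    vertices, so coarea bounds their total variation below by g n Y. The AM-GM bound, with degrees
    at most n, gives the upper bound E/g + (g/2) n Y. The difference leaves E >= (g^2/2) n Y. *)
Lemma cheeger_inequality g x : 0 < g ->
  (forall A, (0 < #|A|)%N -> (#|A|.*2 <= n)%N ->
     g * n%:R * #|A|%:R <= #|boundary A|%:R) ->
  \sum_j x j = 0 -> g ^+ 2 / 2 * n%:R * \sum_j x j ^+ 2 <= energy x.
Proof.
move=> g0 gA x0; have [m [mp mn]] := median_exists x.
pose y j := x j - m.
pose fp j := Num.max 0 (y j) ^+ 2; pose fn j := Num.max 0 (- y j) ^+ 2.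
have Sp : g * n%:R * \sum_j fp j <= variation fp.
  apply: coarea => // [j|]; first exact: sqr_ge0.
  rewrite (_ : [set j | _] = [set j | m < x j]) //; apply/setP => j.
  rewrite !inE sqrf_eq0 /y -subr_gt0; case: ltP => [/gt_eqF->//|_]; by rewrite eqxx.
have Sn : g * n%:R * \sum_j fn j <= variation fn.
  apply: coarea => // [j|]; first exact: sqr_ge0.
  rewrite (_ : [set j | _] = [set j | x j < m]) //; apply/setP => j.
  rewrite !inE sqrf_eq0 /y opprB -(subr_gt0 (x j)).
  case: ltP => [/gt_eqF->//|_]; by rewrite eqxx.
have yy : \sum_j x j ^+ 2 <= \sum_j y j ^+ 2.
  have := @sum_sqr_shift (fun=> 1) x m (fun=> ler01).
  by rewrite /= -!mulr_sumr !mul1r; apply.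
have pn : \sum_j fp j + \sum_j fn j = \sum_j y j ^+ 2.
  rewrite -big_split; apply: eq_bigr => j _; rewrite /fp /fn /=.
  have [y0|y0] := leP 0 (y j).
    by rewrite max_l ?oppr_le0 // expr0n addr0.
  by rewrite max_r ?oppr_ge0 ?ltW // expr0n add0r sqrrN.
have key : variation fp + variation fn <=
    energy x / g + g / 2 * \sum_j (deg j)%:R * y j ^+ 2.
  rewrite -(energy_shift x m) -/y.
  have -> : energy y / g + g / 2 * \sum_j (deg j)%:R * y j ^+ 2 =
      2^-1 * \sum_j \sum_k (adj j k)%:R *
        ((y j - y k) ^+ 2 / g + g / 2 * (y j ^+ 2 + y k ^+ 2)).
    have S : \sum_j \sum_k (adj j k)%:R * y k ^+ 2 = \sum_j (deg j)%:R * y j ^+ 2.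
      rewrite exchange_big sum_deg; apply: eq_bigr => j _; apply: eq_bigr => k _ /=.
      by rewrite adjC.
    transitivity (2^-1 * (g^-1 * \sum_j \sum_k (adj j k)%:R * (y j - y k) ^+ 2
        + g / 2 * \sum_j (deg j)%:R * y j ^+ 2 + g / 2 * \sum_j (deg j)%:R * y j ^+ 2)).
      by rewrite /energy; field; rewrite gt_eqF.
    congr (_ * _); rewrite -{1}S sum_deg !mulr_sumr -!big_split; apply: eq_bigr => j _ /=.
    by rewrite !mulr_sumr -!big_split; apply: eq_bigr => k _ /=; ring.
  rewrite -mulrDr ler_wpM2l ?invr_ge0 ?ler0n // -big_split; apply: ler_sum => j _.
  rewrite -big_split; apply: ler_sum => k _ /=; rewrite -mulrDr.
  by rewrite ler_wpM2l ?ler0n // sqr_parts_variation.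
have dn : \sum_j (deg j)%:R * y j ^+ 2 <= n%:R * \sum_j y j ^+ 2.
  rewrite mulr_sumr; apply: ler_sum => j _.
  by rewrite ler_wpM2r ?sqr_ge0 // ler_nat deg_le_nverts.
have c0 : 0 <= g ^+ 2 / 2 * n%:R by rewrite mulr_ge0 ?ler0n // divr_ge0 ?sqr_ge0.
apply: le_trans (ler_wpM2l c0 yy) _.
have := lerD Sp Sn; rewrite -mulrDr pn => /le_trans/(_ key).
have := ler_wpM2l (ltW g0) dn; set Y := \sum_j y j ^+ 2; set D := \sum_j _.
move=> gD K; have := ler_wpM2l (ltW g0) K.
have -> : g * (energy x / g + g / 2 * D) = energy x + g / 2 * (g * D).
  by field; rewrite gt_eqF.
have := ler_wpM2l (ltW g0) gD; lra.
Qed.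

Lemma cheeger_lambda2 g : 0 < g ->
  g * n%:R <= cheeger R G -> g ^+ 2 / 2 * n%:R <= lambda2 R G.
Proof.
move=> g0 /cheegerP H; apply/lambda2_rayleigh => [|x x0].
  by rewrite !mulr_gt0 ?nverts_gt0 ?exprn_gt0 ?invr_gt0.
exact: cheeger_inequality.
Qed.

Lemma lambda2_cheeger g : 0 < g ->
  g * n%:R <= lambda2 R G -> g / 2 * n%:R <= cheeger R G.
Proof.
move=> g0; have gn : 0 < g * n%:R by rewrite mulr_gt0 ?nverts_gt0.
move=> /(lambda2_rayleigh _ gn) H; apply/cheegerP => A A0 An.
pose m : R := #|A|%:R / n%:R.
have n0 := nverts_gt0.
have := H (fun j => indic A j - m); rewrite energy_shift energy_indic.
rewrite sumrB sum_indic sumr_const card_ord -(mulr_natr m) divfK ?gt_eqF // subrr.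
move=> /(_ erefl); apply: le_trans.
have -> : \sum_j (indic A j - m) ^+ 2 = #|A|%:R * (1 - m).
  have -> : \sum_j (indic A j - m) ^+ 2 =
      \sum_j ((1 - 2 * m) * indic A j + m ^+ 2).
    apply: eq_bigr => j _; rewrite /indic; case: (j \in A) => /=; ring.
  rewrite big_split -mulr_sumr sum_indic sumr_const card_ord -(mulr_natr (m ^+ 2)) /m /=.
  by field; rewrite gt_eqF.
(* The factor 1/2 lost in the constant comes from |A| <= n/2. *)
have m2 : 1 / 2 <= 1 - m.
  suff : m <= 1 / 2 by lra.
  by rewrite /m ler_pdivrMr // mul1r mulrC half_nvertsE.
rewrite -[leLHS]mulr1 (_ : g / 2 * _ * _ * 1 = g * n%:R * (#|A|%:R * (1 / 2))).
  by rewrite !ler_wpM2l // ltW.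
by field.
Qed.

Lemma cheeger_deg g : g * n%:R <= cheeger R G ->
  forall j, g * n%:R <= (deg j)%:R.
Proof.
move=> /cheegerP H j; have := H [set j]; rewrite cards1 mulr1 => /(_ isT).
move=> /(_ (nverts_ge2 G)); rewrite boundary_adj big_set1 deg_adj => /le_trans; apply.
by rewrite ler_nat big_mkcond; apply: leq_sum => k _; case: ifP.
Qed.

Lemma lambda2_chi2 g : 0 < g -> (forall j, (0 < deg j)%N) ->
  g * n%:R <= lambda2 R G -> g <= 1 - chi2 R G.
Proof.
move=> g0 d0; have gn : 0 < g * n%:R by rewrite mulr_gt0 ?nverts_gt0.
move=> /(lambda2_rayleigh _ gn) H; apply/(chi2_rayleigh d0 g0) => x x0.
(* [x] is centred for the degree weights, so shifting by its plain mean can only increase the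
   weighted sum, after which each degree is bounded by n. *)
pose m := (\sum_j x j) / n%:R; have n0 := nverts_gt0.
rewrite -(energy_shift x m); apply: le_trans (H _ _); last first.
  by rewrite sumrB sumr_const card_ord -(mulr_natr m) divfK ?gt_eqF // subrr.
rewrite -mulrA ler_pM2l //.
apply: le_trans (sum_sqr_shift m _ x0) _ => [j|]; first exact: ler0n.
rewrite mulr_sumr; apply: ler_sum => j _.
by rewrite ler_wpM2r ?sqr_ge0 // ler_nat deg_le_nverts.
Qed.

(** The roles of the two means are exchanged: a vector of zero sum is shifted by its degree-weighted
    mean. One factor g comes from the gap of the walk, the other from the lower bound on degrees. *)
Lemma chi2_lambda2 g : 0 < g -> (forall j, g * n%:R <= (deg j)%:R) ->
  g <= 1 - chi2 R G -> g ^+ 2 * n%:R <= lambda2 R G.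
Proof.
move=> g0 gd; have gn : 0 < g * n%:R by rewrite mulr_gt0 ?nverts_gt0.
have d0 j : (0 < deg j)%N by rewrite -(ltr0n R); apply: lt_le_trans (gd j).
move=> /(chi2_rayleigh d0 g0) H; apply/lambda2_rayleigh => [|x x0].
  by rewrite expr2 -mulrA mulr_gt0.
pose D : R := \sum_(j < n) (deg j)%:R; pose m := (\sum_j (deg j)%:R * x j) / D.
have D0 : D != 0.
  rewrite gt_eqF // /D (bigD1 (vertex0 G)) //= ltr_wpDr ?ltr0n ?d0 //.
  by rewrite sumr_ge0 // => j _; rewrite ler0n.
rewrite -(energy_shift x m); apply: le_trans (H _ _); last first.
  under eq_bigr do rewrite mulrBr.
  by rewrite sumrB -mulr_suml mulrC divfK ?subrr.
rewrite expr2 -!mulrA ler_pM2l // mulrA.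
apply: (@le_trans _ _ (g * n%:R * \sum_j (x j - m) ^+ 2)).
  rewrite ler_pM2l //.
  have := @sum_sqr_shift (fun=> 1) x m (fun=> ler01).
  by rewrite /= -!mulr_sumr !mul1r; apply.
by rewrite mulr_sumr; apply: ler_sum => j _; rewrite ler_wpM2r ?sqr_ge0.
Qed.

End Comparison.

(** * Choice of the constant *)

Local Open Scope classical_set_scope.

Theorem theorem1 (R : realType) (gamma0 : R) (hgamma0 : 0 < gamma0) :
  exists gamma : R, 0 < gamma /\
    classF gamma0 `|` classC gamma0 `|` classM gamma0
      `<=` classF gamma `&` classC gamma `&` classM gamma.
Proof.
(* The three entries are the Cheeger bounds obtained from conditions (ii), (i) and (iii); the last
   is half of the [gamma0 ^+ 2] given by [chi2_lambda2]. *)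
pose g1 := Num.min gamma0 (Num.min (gamma0 / 2) (gamma0 ^+ 2 / 2)).
have g1_gt0 : 0 < g1 by rewrite !lt_min hgamma0 !divr_gt0 ?exprn_gt0.
(* Cheeger's inequality turns [g1] into [g2], which bounds both spectral gaps; the degrees keep
   [g1]. *)
pose g2 := g1 ^+ 2 / 2; have g2_gt0 : 0 < g2 by rewrite divr_gt0 ?exprn_gt0.
exists (Num.min g1 g2); split=> [|G FCM]; first by rewrite lt_min g1_gt0.
have mono (g g' y : R) : g' <= g -> g * (nverts G)%:R <= y -> g' * (nverts G)%:R <= y.
  by move=> gg'; apply: le_trans; rewrite ler_wpM2r ?ler0n.
have CG : g1 * (nverts G)%:R <= cheeger R G.
  case: FCM => [[F|C]|[dM M]].
  - by apply: mono (lambda2_cheeger hgamma0 F); rewrite !ge_min lexx !orbT.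
  - by apply: mono C; rewrite ge_min lexx.
  - have F := chi2_lambda2 hgamma0 (proj1 (min_degP _ _) dM) M.
    by apply: mono (lambda2_cheeger _ F); rewrite ?exprn_gt0 // !ge_min lexx !orbT.
have FG := cheeger_lambda2 g1_gt0 CG; have dG := cheeger_deg CG.
have dpos (j : 'I_(nverts G)) : (0 < deg j)%N.
  by rewrite -(ltr0n R); apply: lt_le_trans (dG j); rewrite mulr_gt0 ?nverts_gt0.
have MG := lambda2_chi2 g2_gt0 dpos FG.
split; [split|split].
- by apply: mono FG; rewrite ge_min lexx orbT.
- by apply: mono CG; rewrite ge_min lexx.
- by apply/min_degP => j; apply: mono (dG j); rewrite ge_min lexx.
- by apply: le_trans MG; rewrite ge_min lexx orbT.
Qed.
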